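(* Let $G$ be a finite abelian group with exponent $n_1=2^mp_1^{m_1}\cdots p_r^{m_r}$ ($p_1,\ldots,p_r$ distinct odd primes), and let $\mathcal{A}$ be its group scheme. Let $$\Delta=2^{w_0}(-1)^w\big((-1)^{(p_1-1)/2}p_1\big)^{w_1}\cdots\big((-1)^{(p_r-1)/2}p_r\big)^{w_r}$$ with $w,w_0,\ldots,w_r\in\{0,1\}$, $w_0=0$ if $m<3$ and $w=0$ if $m<2$. Let $$H_\Delta=\Big\{k\in\mathbb{Z}_{n_1}^*:\ \chi(k)^{w_0}\Big(\tfrac k4\Big)^{w}\Big(\tfrac k{p_1}\Big)^{w_1}\cdots\Big(\tfrac k{p_r}\Big)^{w_r}=1\Big\},$$ a subgroup of $\mathbb{Z}_{n_1}^*$, and define $g\sim_\Delta h$ iff $g=kh$ for some $k\in H_\Delta$. Let $C_1,C_2\subseteq G$ be disjoint with $0\notin C_1\cup C_2$, and $M=A_{C_1}-A_{C_2}$. Then: (i) all eigenvalues of $M$ lie in $\mathbb{Q}(\sqrt\Delta)$ if and only if both $C_1$ and $C_2$ are unions of equivalence classes of $\sim_\Delta$; (ii) all eigenvalues of $M$ are integer multiples of $\sqrt\Delta$ if and only if either $\Delta=1$ and $C_1,C_2$ are unions of equivalence classes of $\sim_1$, or $\Delta\ne1$, $C_1$ is a union of equivalence classes of $\sim_\Delta$, and $C_2=kC_1$ for some $k\in\mathbb{Z}_{n_1}^*\setminus H_\Delta$. Moreover, when $\Delta\neq1$ and the conditions in (ii) hold: if $\Delta<0$ then $C_2=-C_1$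 and $M=A_{C_1}-A_{C_1}^T$ is the skew-symmetric adjacency matrix of the oriented Cayley graph $X(G,C_1)$; if $\Delta>0$ then $C_1=-C_1$, $C_2=-C_2$ and $M$ is the symmetric adjacency matrix of the signed Cayley graph $X(G,C_1,C_2)$.
   Context: For a finite abelian group $(G,+)$, $A_g$ is the $(0,1)$-matrix indexed by $G$ with $(A_g)_{u,v}=1$ iff $v-u=g$; the group scheme is $\{A_g:g\in G\}$, and for $C\subseteq G$, $A_C=\sum_{g\in C}A_g$. The exponent $n_1$ is the least positive integer with $n_1g=0$ for all $g\in G$; for $k\in\mathbb{Z}_{n_1}^*$, $kg$ is well defined and $kC=\{kc:c\in C\}$. $\left(\frac kp\right)$ is the Legendre symbol; for odd $k$, $\left(\frac k4\right)=1$ if $k\equiv1\pmod 4$ and $-1$ if $k\equiv3\pmod4$; $\chi(k)=1$ if $k\equiv\pm1\pmod8$ and $\chi(k)=-1$ if $k\equiv\pm3\pmod8$ (these are well defined on $\mathbb{Z}_{n_1}^*$ whenever the corresponding exponent $w_0,w,w_k$ is allowed to be $1$). An oriented Cayley graph $X(G,C)$ with $C\cap(-C)=\emptyset$ has skew-symmetric adjacency matrix $A_C-A_C^T$; a signed Cayley graph $X(G,C(1),C(-1))$ with $C(\pm1)=-C(\pm1)$ disjoint has symmetric adjacency matrix $A_{C(1)}-A_{C(-1)}$. *)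

(* Defs.v *)
From HB Require Import structures.
From mathcomp Require Import all_boot all_order all_algebra all_field.
Set Implicit Arguments. Unset Strict Implicit. Unset Printing Implicit Defensive.
Import Order.TTheory GRing.Theory Num.Theory.
Local Open Scope ring_scope.

Definition is_exponent (G : finZmodType) (n1 : nat) : Prop :=
  (0 < n1)%N /\ (forall g : G, g *+ n1 = 0) /\
  (forall n : nat, (0 < n)%N -> (forall g : G, g *+ n = 0) -> (n1 <= n)%N).

Definition unit_mod (n1 k : nat) : bool := (k < n1)%N && coprime k n1.

Definition legendre (a p : nat) : int :=
  if (p %| a)%N then 0
  else if [exists x : 'I_p, (x * x == a %[mod p])%N] then 1 else -1.

(* (k / 4) for odd k *)
Definition sym4 (k : nat) : int := if (k %% 4 == 1)%N then 1 else -1.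

(* chi(k) for odd k *)
Definition chi8 (k : nat) : int :=
  if (k %% 8 == 1)%N || (k %% 8 == 7)%N then 1 else -1.

(* Delta = 2^w0 (-1)^w prod_{p in S} ((-1)^((p-1)/2) p); S = {p_i : w_i = 1} *)
Definition Delta (w0 w : bool) (S : seq nat) : int :=
  (2 ^+ w0) * (-1) ^+ w * \prod_(p <- S) ((-1) ^+ (p.-1)./2 * p%:Z).

Definition inH (n1 : nat) (w0 w : bool) (S : seq nat) (k : nat) : bool :=
  unit_mod n1 k &&
  (chi8 k ^+ w0 * sym4 k ^+ w * \prod_(p <- S) legendre k p == 1).

Definition simD (G : finZmodType) n1 w0 w S (g h : G) : Prop :=
  exists k, inH n1 w0 w S k /\ g = h *+ k.

Definition union_of_classes (G : finZmodType) n1 w0 w S (C : {set G}) : Prop :=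
  forall g h : G, simD n1 w0 w S g h -> (g \in C) = (h \in C).

Definition scale_set (G : finZmodType) (k : nat) (C : {set G}) : {set G} :=
  [set c *+ k | c in C].

Definition neg_set (G : finZmodType) (C : {set G}) : {set G} :=
  [set - c | c in C].

Definition Amat (G : finZmodType) (C : {set G}) : 'M[algC]_#|G| :=
  \matrix_(i, j) ((enum_val j - enum_val i \in C)%:R : algC).

(* Main.v *)
Require Import Defs.
From HB Require Import structures.
From mathcomp Require Import all_boot all_order all_algebra all_field.
From mathcomp Require Import fingroup character classfun ring.
Import Order.TTheory GRing.Theory Num.Theory.
Local Open Scope ring_scope.

(** The eigenvalues of [M] are the Fourier coefficients [sum_h f(h) psi(h)] of
    [f = 1_{C1} - 1_{C2}] at the characters [psi] of [G], so they lie in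
    [Q(zeta)] for a primitive root of unity [zeta] of order [n1].  The
    automorphism [zeta |-> zeta^k] multiplies all of them by a sign [e] iff
    [f(k g) = e f(g)] for all [g], by uniqueness of Fourier coefficients.
    Gauss sums, [i] and [zeta_8 + zeta_8^-1] give [d] in [Q(zeta)] with
    [d^2 = Delta] on which this automorphism acts by the sign [c(k)] defining
    [H_Delta].  Multiplicativity of [c], its nontriviality for [Delta <> 1] and
    the value [c(-1) = sgn Delta] are all read off this action (complex
    conjugation is [k = -1]).  An element of [Q(zeta)] fixed by [H_Delta] is
    then in [Q(d)], and a rational multiple of [d] which is an algebraic
    integer is an integer multiple, as [Delta] is squarefree. *)

(** * Euler criterion and Gauss sums *)

Section Legendre.
Variable p : nat.
Hypotheses (p_pr : prime p) (p_odd : odd p).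
Let h := (p.-1)./2.

Lemma half_prime : p = h.*2.+1.
Proof.
rewrite -[LHS](odd_double_half p) p_odd /h.
by case: p p_pr p_odd => //= q _ /negPf; rewrite uphalf_half => ->.
Qed.

Lemma expFp_half (x : 'F_p) : x != 0 -> x ^+ h ^+ 2 = 1.
Proof.
move=> x0; apply: (mulfI x0); rewrite mulr1 -exprM -exprS.
by rewrite muln2 -half_prime -{2}[x]expf_card card_Fp.
Qed.

Lemma natFp_eq0 (a : nat) : ((a%:R : 'F_p) == 0) = (p %| a)%N.
Proof. by rewrite (dvdn_pcharf (pchar_Fp p_pr)). Qed.

Lemma Fp_two_neq0 : (2%:R : 'F_p) != 0.
Proof. by rewrite natFp_eq0 dvdn_prime2 //; apply: contraL p_odd => /eqP->. Qed.

(** Equal squares force i = j or i + j = 0 modulo p, and 0 < i + j < p rules out the latter. *)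
Lemma half_squares_uniq : uniq [seq (i%:R : 'F_p) ^+ 2 | i <- iota 1 h].
Proof.
rewrite map_inj_in_uniq ?iota_uniq // => i j.
rewrite !mem_iota !add1n !ltnS => /andP[i0 ih] /andP[j0 jh] /eqP.
have lep k l : (k <= h -> l <= h -> k + l < p)%N.
  by move=> kh lh; rewrite half_prime ltnS -addnn leq_add.
rewrite eqf_sqr => /orP[/eqP eqij|].
  have lt k : (k <= h -> k < p)%N by move=> kh; have := lep k 0 kh isT; rewrite addn0.
  move/(congr1 val): eqij; rewrite /= !val_Fp_nat //.
  by rewrite !modn_small ?lt.
rewrite -subr_eq0 opprK -natrD natFp_eq0 => /dvdn_leq.
by rewrite addn_gt0 i0 => /(_ isT); rewrite leqNgt lep.
Qed.

(* A nonresidue cannot be a root of X^h - 1, as the h nonzero squares already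
   are all its roots. *)
Lemma euler_criterion (a : nat) :
  ((legendre a p)%:~R : 'F_p) = a%:R ^+ h.
Proof.
have h0 : (0 < h)%N.
  by have := prime_gt1 p_pr; rewrite half_prime ltnS double_gt0.
rewrite /legendre; case: ifPn => [|pa].
  by rewrite -natFp_eq0 => /eqP->; rewrite expr0n eqn0Ngt h0.
have a0 : (a%:R : 'F_p) != 0 by rewrite natFp_eq0.
case: ifPn => [/existsP[x /eqP xa]|nsq].
  have -> : a%:R = (x%:R : 'F_p) ^+ 2.
    by apply: val_inj; rewrite -natrX /= !val_Fp_nat // -xa.
  rewrite exprAC expFp_half // natFp_eq0.
  by apply: contra pa => px; rewrite /dvdn -xa; apply: dvdn_mulr.
have := expFp_half _ a0; move/eqP; rewrite sqrf_eq1 => /orP[/eqP ah1|/eqP-> //].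
pose rs := (a%:R : 'F_p) :: [seq (i%:R : 'F_p) ^+ 2 | i <- iota 1 h].
have P0 : ('X^h - 1 : {poly 'F_p}) != 0 by rewrite monic_neq0 ?monicXnsubC.
have urs : uniq rs.
  rewrite /= half_squares_uniq andbT; apply: contra nsq.
  case/mapP=> i; rewrite mem_iota add1n ltnS => /andP[i0 ih] ai.
  have ip : (i < p)%N.
    by rewrite half_prime ltnS (leq_trans ih) // -addnn leq_addr.
  apply/existsP; exists (Ordinal ip) => /=; apply/eqP.
  by have := congr1 val ai; rewrite -natrX /= !val_Fp_nat.
have ars : all (root ('X^h - 1)) rs.
  apply/allP=> x; rewrite inE rootE !hornerE => /predU1P[->|].
    by rewrite ah1 subrr.
  case/mapP=> i; rewrite mem_iota add1n ltnS => /andP[i0 ih] ->.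
  rewrite exprAC expFp_half ?subrr // natFp_eq0 gtnNdvd //.
  by rewrite half_prime ltnS (leq_trans ih) // -addnn leq_addr.
by have := max_poly_roots P0 ars urs; rewrite size_XnsubC //= size_map size_iota ltnn.
Qed.

Lemma legendre_range a : legendre a p \in [:: 0; 1; -1].
Proof. by rewrite /legendre; do 2?case: ifP. Qed.

(** As p is odd, 0, 1 and -1 stay distinct modulo p; so identities between Legendre symbols may be
    checked in ['F_p], where Euler's criterion applies. *)
Lemma legendre_inj (x y : int) : x \in [:: 0; 1; -1] -> y \in [:: 0; 1; -1] ->
  (x%:~R : 'F_p) = y%:~R -> x = y.
Proof.
have n1 : (1 : 'F_p) != 0 by rewrite oner_eq0.
have n2 : (1 : 'F_p) != -1 by rewrite -subr_eq0 opprK Fp_two_neq0.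
rewrite !inE => /or3P[]/eqP-> /or3P[]/eqP-> //=;
  rewrite ?mulr0z ?mulr1z ?mulrNz ?mulr1z => /eqP;
  rewrite ?oppr_eq0 1?eq_sym ?oppr_eq0 ?(negPf n1) ?(negPf n2) //;
  by rewrite eq_sym ?oppr_eq0 ?(negPf n1) ?(negPf n2).
Qed.

Lemma legendreM a b : legendre (a * b) p = legendre a p * legendre b p.
Proof.
apply: legendre_inj; rewrite ?legendre_range //.
  move: (legendre_range a) (legendre_range b); rewrite !inE.
  by move=> /or3P[]/eqP-> /or3P[]/eqP->.
by rewrite rmorphM /= !euler_criterion natrM exprMn.
Qed.

Lemma legendre_mod a : legendre (a %% p) p = legendre a p.
Proof.
by apply: legendre_inj; rewrite ?legendre_range // !euler_criterion Fp_nat_mod.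
Qed.

Lemma legendre_N1 : legendre p.-1 p = (-1) ^+ h.
Proof.
apply: legendre_inj; rewrite ?legendre_range ?euler_criterion //.
  by rewrite -signr_odd; case: (odd h).
rewrite rmorphXn /= rmorphN1; congr (_ ^+ _); apply/eqP.
by rewrite -subr_eq0 opprK natr1 prednK ?prime_gt0 // natFp_eq0.
Qed.

Lemma legendre_sqr a : ~~ (p %| a)%N -> legendre a p ^+ 2 = 1.
Proof. by rewrite /legendre => /negPf->; case: ifP. Qed.

(** X^h - 1 has at most h roots among the 2h nonzero residues; any other nonzero x has x^h = -1. *)
Lemma legendre_nonresidue : exists a, legendre a p = -1.
Proof.
have h0 : (0 < h)%N.
  by have := prime_gt1 p_pr; rewrite half_prime ltnS double_gt0.
have P0 : ('X^h - 1 : {poly 'F_p}) != 0 by rewrite monic_neq0 ?monicXnsubC.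
have /allPn[x] : ~~ all (root ('X^h - 1)) (enum (predC1 (0 : 'F_p))).
  apply/negP=> /(max_poly_roots P0)/(_ (enum_uniq _)).
  rewrite size_XnsubC // -cardE cardC1 card_Fp // half_prime /= ltnS -addnn.
  by rewrite -{3}[h]addn0 leq_add2l leqNgt h0.
rewrite mem_enum inE rootE !hornerE subr_eq0 => x0 xh; exists x.
apply: legendre_inj; rewrite ?legendre_range ?euler_criterion //.
rewrite natr_Zp rmorphN1; apply/eqP.
by have /eqP := expFp_half _ x0; rewrite sqrf_eq1 (negPf xh).
Qed.

Section GaussSum.
Variable ze : algC.
Hypothesis ze_prim : p.-primitive_root ze.
Let l (a : 'F_p) : algC := (legendre a p)%:~R.
Let e (a : 'F_p) : algC := ze ^+ a.

Definition gauss_sum : algC := \sum_(a : 'F_p) (legendre a p)%:~R * ze ^+ a.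

Lemma valFpM (a b : 'F_p) : (a * b : 'F_p) = ((a * b) %% p)%N :> nat.
Proof. by rewrite -val_Fp_nat // natrM !natr_Zp. Qed.

Lemma valFpD (a b : 'F_p) : (a + b : 'F_p) = ((a + b) %% p)%N :> nat.
Proof. by rewrite -val_Fp_nat // natrD !natr_Zp. Qed.

Let lM a b : l (a * b) = l a * l b.
Proof. by rewrite /l valFpM legendre_mod legendreM rmorphM. Qed.

Let eD a b : e (a + b) = e a * e b.
Proof. by rewrite /e valFpD prim_expr_mod // exprD. Qed.

Let e0 : e 0 = 1. Proof. by rewrite /e expr0. Qed.
Let l0 : l 0 = 0. Proof. by rewrite /l /legendre dvdn0. Qed.

Let lsqr a : a != 0 -> l a * l a = 1.
Proof.
move=> a0; rewrite -rmorphM -expr2 legendre_sqr //.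
by rewrite -natFp_eq0 natr_Zp.
Qed.

(** Multiplying the index by a nonresidue permutes ['F_p] and changes the sign of every term. *)
Let sum_l : \sum_a l a = 0.
Proof.
have [b lb] := legendre_nonresidue.
have lb' : l b%:R = -1 by rewrite /l val_Fp_nat // legendre_mod lb rmorphN1.
have b0 : (b%:R : 'F_p) != 0.
  by apply: contra_eq_neq lb' => ->; rewrite l0 eq_sym oppr_eq0 oner_eq0.
have : \sum_a l a = - \sum_a l a.
  rewrite {1}(reindex_inj (mulfI b0)) -sumrN; apply: eq_bigr => a _.
  by rewrite lM lb' mulN1r.
move/eqP; rewrite -subr_eq0 opprK -mulr2n -mulr_natl mulf_eq0 pnatr_eq0.
by move/eqP.
Qed.

(** For c != 0, translating the index by 1 multiplies the sum by [e 1], which is not 1 because [ze]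
    has order p. *)
Let sum_e c : \sum_a e (a * c) = if c == 0 then p%:R else 0.
Proof.
case: ifPn => [/eqP->|c0].
  under eq_bigr do rewrite mulr0 e0.
  by rewrite sumr_const card_Fp.
have <- : \sum_a e a = \sum_a e (a * c) by exact: (reindex_inj (mulIf c0)).
set s := \sum_a e a.
have : e 1 * s = s.
  rewrite mulr_sumr [RHS](reindex_inj (addrI 1)).
  by apply: eq_bigr => a _; rewrite eD.
move/eqP; rewrite -subr_eq0 -{2}[s]mul1r -mulrBl mulf_eq0 subr_eq0.
case/orP=> [|/eqP //]; rewrite /e -[ze ^+ _]/(ze ^+ 1%N) -(prim_order_dvd ze_prim).
by rewrite dvdn1 => /eqP p1; move: p_pr; rewrite p1.
Qed.

(** The substitution a -> a k turns the right side into the image under [u], because l(k) l(ak) =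
    l(k)^2 l(a) = l(a). *)
Lemma gauss_sum_aut (u : {rmorphism algC -> algC}) k :
  ~~ (p %| k)%N -> u ze = ze ^+ k ->
  u gauss_sum = (legendre k p)%:~R * gauss_sum.
Proof.
move=> pk uz; have k0 : (k%:R : 'F_p) != 0 by rewrite natFp_eq0.
have lk : (legendre k p)%:~R = l k%:R by rewrite /l val_Fp_nat // legendre_mod.
rewrite lk /gauss_sum rmorph_sum mulr_sumr /= [RHS](reindex_inj (mulIf k0)).
apply: eq_bigr => a _; transitivity (l a * e (a * k%:R)); last first.
  rewrite -[RHS]/(l k%:R * (l (a * k%:R) * e (a * k%:R))).
  by rewrite lM [l a * l _]mulrC !mulrA lsqr // mul1r.
rewrite rmorphM rmorph_int rmorphXn uz -exprM; congr (_ * _).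
by rewrite /e valFpM val_Fp_nat // modnMmr prim_expr_mod // mulnC.
Qed.

(* Substituting b = a c in the double sum leaves p l(-1) - sum_c l(c). *)
Lemma gauss_sum_sqr : gauss_sum ^+ 2 = ((-1) ^+ h * p%:Z)%:~R.
Proof.
rewrite expr2 {1}/gauss_sum mulr_suml (bigD1 0) //=.
rewrite -[_%:~R]/(l 0) l0 !mul0r add0r.
have -> : \sum_(a : 'F_p | a != 0) l a * e a * gauss_sum =
          \sum_(a : 'F_p | a != 0) \sum_c l c * e (a * (1 + c)).
  apply: eq_bigr => a a0; rewrite /gauss_sum mulr_sumr (reindex_inj (mulfI a0)).
  apply: eq_bigr => c _; rewrite -[LHS]/(l a * e a * (l (a * c) * e (a * c))).
  by rewrite lM mulrACA [l a * (l a * _)]mulrA lsqr // mul1r -eD mulrDr mulr1.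
rewrite exchange_big /=.
have inner c : \sum_(a : 'F_p | a != 0) l c * e (a * (1 + c)) =
      l c * (if 1 + c == 0 then p%:R else 0) - l c.
  rewrite -sum_e mulr_sumr [X in _ = X - _](bigD1 0) //= mul0r e0 mulr1.
  by rewrite addrC addrK.
rewrite (eq_bigr _ (fun c _ => inner c)) sumrB sum_l subr0 (bigD1 (-1)) //=.
rewrite subrr eqxx big1 ?addr0 => [|c cN1]; last first.
  by rewrite addrC addr_eq0 (negPf cN1) mulr0.
rewrite rmorphM /= -legendre_N1; congr (_%:~R * _).
rewrite -legendre_mod -[in RHS]legendre_mod; congr legendre.
rewrite -!val_Fp_nat // natr_Zp; congr val; apply/eqP; rewrite eq_sym.
by rewrite -subr_eq0 opprK natr1 prednK ?prime_gt0 // natFp_eq0.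
Qed.
End GaussSum.
End Legendre.

(** * Square roots of Delta in cyclotomic fields *)

(** For algebraic [z] the values of rational polynomials at [z] already form the field Q(z). *)
Definition in_cyclo (z x : algC) : Prop :=
  exists p : {poly rat}, x = (map_poly ratr p).[z].

(** This is the form in which [Qn_aut_exists] delivers automorphisms: prescribed on n-th roots of
    unity, with no uniqueness claimed on the rest of [algC]. *)
Definition acts_as_power (n k : nat) (u : algC -> algC) : Prop :=
  forall y, y ^+ n = 1 -> u y = y ^+ k.

Section Cyclo.
Variable z : algC.

Lemma in_cyclo_rat (a : rat) : in_cyclo z (ratr a).
Proof. by exists a%:P; rewrite map_polyC hornerC. Qed.

Lemma in_cyclo_int (a : int) : in_cyclo z a%:~R.
Proof. by rewrite -ratr_int; apply: in_cyclo_rat. Qed.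

Lemma in_cycloD x y : in_cyclo z x -> in_cyclo z y -> in_cyclo z (x + y).
Proof. by move=> [p ->] [q ->]; exists (p + q); rewrite rmorphD hornerD. Qed.

Lemma in_cycloM x y : in_cyclo z x -> in_cyclo z y -> in_cyclo z (x * y).
Proof. by move=> [p ->] [q ->]; exists (p * q); rewrite rmorphM hornerM. Qed.

Lemma in_cyclo_exp i : in_cyclo z (z ^+ i).
Proof. by exists 'X^i; rewrite map_polyXn hornerXn. Qed.

Lemma in_cyclo_sum (I : finType) (F : I -> algC) :
  (forall i, in_cyclo z (F i)) -> in_cyclo z (\sum_i F i).
Proof.
move=> h; apply: big_ind => //; first exact: (in_cyclo_int 0).
exact: in_cycloD.
Qed.
End Cyclo.

(** A ring morphism fixes the rational coefficients, so on Q(z) it is determined by the image of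
    [z]. *)
Lemma in_cyclo_aut z x (u v : {rmorphism algC -> algC}) :
  u z = v z -> in_cyclo z x -> u x = v x.
Proof.
have Q (w : {rmorphism algC -> algC}) (p : {poly rat}) :
    w (map_poly ratr p).[z] = (map_poly ratr p).[w z].
  rewrite -horner_map -map_poly_comp; congr _.[_].
  by apply: eq_map_poly => a /=; rewrite fmorph_rat.
by move=> uv [p ->]; rewrite !Q uv.
Qed.

Lemma totient_units n : #|[pred i : 'I_n | coprime i n]| = totient n.
Proof.
rewrite totient_count_coprime -sum1_card big_mkord -big_mkcond /=.
by apply: eq_bigl => i; rewrite inE coprime_sym.
Qed.

(* Reduce P modulo the minimal polynomial of z, where x = P(z): the result
   minus x vanishes at all totient n conjugates of z, so it is zero. *)
Lemma cyclo_fixed_rat n z x : n.-primitive_root z -> in_cyclo z x ->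
    (forall k (u : {rmorphism algC -> algC}), coprime k n ->
       acts_as_power n k u -> u x = x) ->
  x \in Crat.
Proof.
move=> zn [p xE] fix_x; have n0 := prim_order_gt0 zn.
have [m [mE mmon _]] := minCpolyP z.
pose q := p %% m; pose qC : {poly algC} := map_poly ratr q.
have mz : (map_poly ratr m).[z] = 0.
  by apply/rootP; rewrite -mE root_minCpoly.
have qz : qC.[z] = x.
  rewrite xE {1}(divp_eq p m) rmorphD rmorphM /= hornerD hornerM mz.
  by rewrite mulr0 add0r.
pose rs := [seq z ^+ i | i : 'I_n in [pred i : 'I_n | coprime i n]].
have urs : uniq rs.
  rewrite map_inj_in_uniq ?enum_uniq // => i j _ _ /eqP.
  by rewrite (eq_prim_root_expr zn) !modn_small // => /eqP/val_inj.
have srs : size rs = totient n by rewrite size_map -cardE totient_units.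
have sm : size m = (totient n).+1.
  rewrite -(size_map_poly (ratr : {rmorphism rat -> algC})) -mE.
  by rewrite (minCpoly_cyclotomic zn) size_cyclotomic.
have sq : (size q <= totient n)%N.
  by rewrite -ltnS -sm ltn_modp monic_neq0.
have ars : all (root (qC - x%:P)) rs.
  apply/allP=> y /imageP[i]; rewrite inE => co ->.
  have [u hu] := Qn_aut_exists co.
  rewrite rootE !hornerE subr_eq0; apply/eqP.
  rewrite -[RHS](fix_x i u co hu) -[in RHS]qz -horner_map (hu _ (prim_expr_order zn)).
  rewrite -map_poly_comp; congr _.[_].
  by apply: eq_map_poly => a /=; rewrite fmorph_rat.
have /eqP q0 : qC - x%:P == 0.
  apply: contraT => nz; have := max_poly_roots nz ars urs.
  rewrite srs ltnNge => /negP[]; apply: leq_trans (size_polyD _ _) _.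
  rewrite geq_max size_map_poly sq size_polyN size_polyC.
  by case: (x != 0); rewrite //= totient_gt0.
have /(congr1 (fun r : {poly algC} => r`_0)) : qC = x%:P
  by apply/eqP; rewrite -subr_eq0 q0.
by rewrite coef_map coefC /= => <-; apply: Crat_rat.
Qed.

(** On units, [c] is the Galois character attached to Q(sqrt D). The condition is stable under
    products ([quadraticM]), so Delta can be treated one factor at a time. *)
Definition quadratic (n : nat) (z : algC) (D : int) (c : nat -> int) : Prop :=
  exists d : algC, [/\ in_cyclo z d, d ^+ 2 = D%:~R &
    forall k (u : {rmorphism algC -> algC}), coprime k n ->
      acts_as_power n k u -> u d = (c k)%:~R * d].

Lemma quadratic1 n z : quadratic n z 1 (fun => 1).
Proof.
exists 1; split; first exact: (in_cyclo_int _ 1); first by rewrite expr1n.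
by move=> k u _ _; rewrite rmorph1 mulr1.
Qed.

Lemma quadraticM n z D1 D2 c1 c2 : quadratic n z D1 c1 -> quadratic n z D2 c2 ->
  quadratic n z (D1 * D2) (fun k => c1 k * c2 k).
Proof.
move=> [d1 [i1 s1 a1]] [d2 [i2 s2 a2]]; exists (d1 * d2); split.
- exact: in_cycloM.
- by rewrite exprMn s1 s2 rmorphM.
by move=> k u co hu; rewrite rmorphM (a1 k u co hu) (a2 k u co hu) mulrACA -rmorphM.
Qed.

Section CyclotomicSquareRoots.
Variables (n : nat) (z : algC).
Hypothesis zn : n.-primitive_root z.

Lemma dvdn_root_power d k (u : algC -> algC) : acts_as_power n k u ->
  u (z ^+ (n %/ d)) = z ^+ (n %/ d) ^+ k.
Proof. by apply; rewrite exprAC (prim_expr_order zn) expr1n. Qed.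

Lemma quadratic_prime p : prime p -> odd p -> (p %| n)%N ->
  quadratic n z ((-1) ^+ (p.-1)./2 * p%:Z) (legendre^~ p).
Proof.
move=> pp op pn; have zp := dvdn_prim_root zn pn.
exists (gauss_sum p (z ^+ (n %/ p))); split.
- apply: in_cyclo_sum => a; apply: in_cycloM; first exact: in_cyclo_int.
  by rewrite -exprM; apply: in_cyclo_exp.
- exact: gauss_sum_sqr.
move=> k u co hu; apply: gauss_sum_aut => //; last exact: dvdn_root_power.
by rewrite -prime_coprime // coprime_sym; apply: coprime_dvdr co.
Qed.

(** The root is y = z^(n/4), of order 4: y^k is y or y^3 = -y according to k modulo 4. *)
Lemma quadraticN1 : (4 %| n)%N -> quadratic n z (-1) sym4.
Proof.
move=> dn; have y4 := dvdn_prim_root zn dn; set y := z ^+ _ in y4.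
have y2 : y ^+ 2 = -1.
  have /eqP := prim_expr_order y4; rewrite (exprM y 2 2) sqrf_eq1 => /orP[]/eqP// y2.
  by have := prim_order_dvd y4 2; rewrite y2 eqxx.
exists y; split; first exact: in_cyclo_exp; first by rewrite y2 rmorphN1.
move=> k u co hu; rewrite (dvdn_root_power _ _ _ hu) -/y -(prim_expr_mod y4) /sym4.
have : odd (k %% 4)%N.
  by rewrite odd_mod // -coprimen2; apply: coprime_dvdr co; apply: dvdn_trans dn.
have := ltn_pmod k (isT : 0 < 4)%N.
case: (k %% 4)%N => [|[|[|[|]]]] //= _ _; first by rewrite mul1r.
by rewrite exprS y2 mulrC.
Qed.

Lemma quadratic2 : (8 %| n)%N -> quadratic n z 2 chi8.
Proof.
move=> dn; have y8 := dvdn_prim_root zn dn; set y := z ^+ _ in y8.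
have iy i : in_cyclo z (y ^+ i) by rewrite -exprM; apply: in_cyclo_exp.
have uy k (u : {rmorphism algC -> algC}) : acts_as_power n k u -> u y = y ^+ k.
  exact: dvdn_root_power.
clearbody y.
have y4 : y ^+ 4 = -1.
  have /eqP := prim_expr_order y8; rewrite (exprM y 4 2) sqrf_eq1 => /orP[]/eqP// y4.
  by have := prim_order_dvd y8 4; rewrite y4 eqxx.
have y7 : y * y ^+ 7 = 1 by rewrite -exprS prim_expr_order.
exists (y + y ^+ 7); split.
- exact: in_cycloD (iy 1%N) (iy 7%N).
(* y^14 = y^6 = -y^2 cancels y^2, leaving the cross term 2 y y^7 = 2. *)
- rewrite sqrrD y7 -exprM -(prim_expr_mod y8 (7 * 2)) (_ : 7 * 2 %% 8 = 2 + 4)%N //.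
  by rewrite exprD y4 mulrN1 addrAC subrr add0r.
move=> k u co hu; rewrite rmorphD rmorphXn /= (uy k u hu).
rewrite -(prim_expr_mod y8 k) /chi8.
have : odd (k %% 8)%N.
  by rewrite odd_mod // -coprimen2; apply: coprime_dvdr co; apply: dvdn_trans dn.
have := ltn_pmod k (isT : 0 < 8)%N.
(* Only 1, 3, 5, 7 survive. Here y + y^7 = y - y^3: exponent 7 swaps the two summands, exponents 3
   and 5 negate the sum. *)
case: (k %% 8)%N => [|[|[|[|[|[|[|[|]]]]]]]] //= _ _; rewrite -?exprM.
- by rewrite mul1r.
- rewrite -(prim_expr_mod y8 (3 * 7)) /= (_ : 3 * 7 %% 8 = 1 + 4)%N // exprD y4.
  by rewrite (exprD y 3 4) y4 !mulrN1 mulN1r opprD opprK addrC.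
- rewrite -(prim_expr_mod y8 (5 * 7)) /= (_ : 5 * 7 %% 8 = 3)%N //.
  by rewrite (exprD y 3 4) (exprD y 1 4) y4 !mulrN1 mulN1r opprD opprK.
by rewrite -(prim_expr_mod y8 (7 * 7)) /= addrC mul1r.
Qed.

Lemma quadratic_Delta (w0 w : bool) (S : seq nat) :
    (forall p, p \in S -> [&& prime p, odd p & (p %| n)%N]) ->
    (w0 -> (8 %| n)%N) -> (w -> (4 %| n)%N) ->
  quadratic n z (Delta w0 w S)
    (fun k => chi8 k ^+ w0 * sym4 k ^+ w * \prod_(p <- S) legendre k p).
Proof.
move=> HS H0 H4; apply: quadraticM; first apply: quadraticM.
- by case: w0 H0 => [/(_ isT)/quadratic2|_]; [apply|apply: (quadratic1 n z)].
- by case: w H4 => [/(_ isT)/quadraticN1|_]; [apply|apply: (quadratic1 n z)].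
elim: S HS => [|p S IH] HS.
  have [d [? ? hd]] := quadratic1 n z.
  by exists d; split; rewrite ?big_nil // => k u co hu; rewrite big_nil; apply: hd co hu.
have /and3P[pp op pn] := HS p (mem_head p S).
have [|d [? sd hd]] := quadraticM _ _ _ _ _ _ (quadratic_prime _ pp op pn) (IH _).
  by move=> q qS; apply: HS; rewrite inE qS orbT.
exists d; split; rewrite ?big_cons // => k u co hu.
by rewrite big_cons; apply: hd co hu.
Qed.
End CyclotomicSquareRoots.

(** * Squarefree integers and rational square roots *)

(** The sign of [D] is ignored, and 0 is excluded because every square divides it. *)
Definition squarefree (D : int) : Prop := forall q, prime q -> ~~ (q ^ 2 %| `|D|)%N.

Lemma logn_prod_primes q (S : seq nat) : {in S, forall p, prime p} ->
  logn q (\prod_(p <- S) p) = count_mem q S.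
Proof.
elim: S => [|p S IH] HS; first by rewrite big_nil logn1.
have pp := HS p (mem_head p S).
have pS : {in S, forall p, prime p} by move=> r rS; apply: HS; rewrite inE rS orbT.
have S0 : (0 < \prod_(p <- S) p)%N.
  by rewrite big_seq; apply: prodn_cond_gt0 => r /pS/prime_gt0.
by rewrite big_cons lognM ?(prime_gt0 pp) // IH // logn_prime //= eq_sym.
Qed.

Lemma abs_Delta w0 w S :
  `|Delta w0 w S|%N = (\prod_(p <- (if w0 then [:: 2] else [::]) ++ S) p)%N.
Proof.
rewrite /Delta big_cat !abszM !abszX /= exp1n muln1; congr (_ * _)%N.
  by case: w0; rewrite ?big_seq1 ?big_nil.
elim: S => [|p S IH]; first by rewrite !big_nil.
by rewrite !big_cons !abszM IH abszX exp1n mul1n.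
Qed.

(** The valuation of |Delta| at q is the multiplicity of q in a list of distinct primes: those of
    [S], which are odd, and 2 when [w0] holds. *)
Lemma squarefree_Delta w0 w S : uniq S -> {in S, forall p, prime p && odd p} ->
  squarefree (Delta w0 w S).
Proof.
move=> uS HS q qp; rewrite abs_Delta.
set T := _ ++ S.
have pT : {in T, forall p, prime p}.
  move=> p; rewrite mem_cat => /orP[|/HS/andP[]//].
  by case: w0 {T}; rewrite ?inE => // /eqP->.
have uT : uniq T.
  rewrite cat_uniq uS andbT; case: w0 {T pT} => //=; first last.
    by apply/hasPn.
  by apply/hasPn=> p /HS/andP[_]; rewrite inE; apply: contraL => /eqP->.
have T0 : (0 < \prod_(p <- T) p)%N.
  by rewrite big_seq; apply: prodn_cond_gt0 => p /pT/prime_gt0.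
by rewrite pfactor_dvdn // logn_prod_primes // count_uniq_mem //; case: (q \in T).
Qed.

(** Write s = a/b in lowest terms: b^2 divides a^2 D, hence D, so b = 1. *)
Lemma squarefree_mul_sqr (D : int) (s : rat) : squarefree D ->
  (s ^+ 2 * D%:~R) \is a Num.int -> s \is a Num.int.
Proof.
move=> sqD /intrP[m sm].
have d0 : (denq s)%:~R != 0 :> rat by rewrite intr_eq0 denq_neq0.
have eq1 : numq s ^+ 2 * D = m * denq s ^+ 2.
  apply: (@intr_inj rat); rewrite rmorphM rmorphXn [RHS]rmorphM rmorphXn /= -sm.
  by rewrite -{2}[s]divq_num_den expr_div_n [RHS]mulrAC divfK ?expf_neq0.
have dvd : (`|denq s| ^ 2 %| `|D|)%N.
  have := congr1 absz eq1; rewrite abszM abszX [in RHS]abszM [in RHS]abszX => eq2.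
  have cop : coprime (`|denq s| ^ 2) (`|numq s| ^ 2).
    by apply: coprimeXl; apply: coprimeXr; rewrite coprime_sym coprime_num_den.
  by rewrite -(Gauss_dvdr _ cop) eq2; apply: dvdn_mull.
have d1 : denq s = 1.
  have dn : (0 < `|denq s|)%N by rewrite absz_gt0 denq_neq0.
  case: (ltnP 1 `|denq s|) => [d1|d1].
    have := sqD _ (pdiv_prime d1); rewrite (dvdn_trans _ dvd) //.
    by rewrite dvdn_exp2r // pdiv_dvd.
  have {}d1 : `|denq s|%N = 1%N by apply/eqP; rewrite eqn_leq d1.
  by rewrite -(absz_denq s) d1.
by rewrite -[s]divq_num_den d1 divr1 intr_int.
Qed.

(** The previous lemma, taken with the squarefree integer 1, makes [s] an integer m; a prime factor
    of m would have its square dividing D = m^2. *)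
Lemma squarefree_sqr (D : int) (s : rat) : squarefree D -> s ^+ 2 = D%:~R -> D = 1.
Proof.
move=> sqD sD.
have /intrP[m sm] : s \is a Num.int.
  apply: (squarefree_mul_sqr 1) => [q /prime_gt1 q1|].
    by rewrite dvdn1 -(expn0 q) eqn_exp2l.
  by rewrite mulr1 sD intr_int.
have Dm : D = m ^+ 2 by apply: (@intr_inj rat); rewrite rmorphXn /= -sm sD.
rewrite Dm -(real_normK (num_real m)) -abszE.
have -> : `|m|%N = 1%N; last by [].
have [m1|] := ltnP 1 `|m|.
  have := sqD _ (pdiv_prime m1); rewrite Dm abszX dvdn_exp2r // pdiv_dvd //.
rewrite leq_eqVlt ltnS leqn0 => /orP[/eqP//|/eqP m0].
by have := sqD 2%N isT; rewrite Dm abszX m0 dvdn0.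
Qed.

(** * Characters and Cayley eigenvalues *)

Section Characters.
Variable G : finZmodType.

Definition is_character (psi : G -> algC) : Prop :=
  psi 0 = 1 /\ forall x y, psi (x + y) = psi x * psi y.

Lemma characterMn psi x k : is_character psi -> psi (x *+ k) = psi x ^+ k.
Proof.
move=> [p0 pD]; elim: k => [|k IH]; first by rewrite mulr0n expr0.
by rewrite mulrS exprS pD IH.
Qed.

(** Fourier inversion: weighting the coefficients by the conjugates of chi_i(g) and summing over i
    gives |G| f(g), so they cannot all vanish. *)
Lemma character_nonvanishing (f : G -> algC) g : f g != 0 ->
  exists2 psi, is_character psi & \sum_h f h * psi h != 0.
Proof.
have ab : abelian [set: G]%G by exact: FinRing.zmod_abelian.
have lin (i : Iirr [set: G]%G) : is_character ('chi_i : G -> algC).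
  have li := char_abelianP _ ab i; split; first exact: lin_char1.
  by move=> x y; rewrite -(lin_charM li) ?inE.
have orth x : \sum_i 'chi[[set: G]%G]_i x * ('chi_i g)^* =
    if x == g then #|G|%:R else 0.
  rewrite second_orthogonality_relation ?inE //.
  (* In an abelian group centralizers are everything and conjugacy classes are singletons, so second
     orthogonality separates the points of [G]. *)
  have -> : 'C_([set: G])[x]%g = [set: G].
    apply/setP=> y; rewrite in_setI !in_setT; apply/cent1P.
    by have /centsP := ab; apply; rewrite inE.
  have -> : (g ^: [set: G] = [set g])%g.
    apply/setP=> y; rewrite inE; apply/imsetP/eqP => [[z _ ->]|->].
      by apply/conjg_fixP/commgP; have /centsP := ab; apply; rewrite inE.
    by exists 1%g; rewrite ?inE ?conjg1.
  by rewrite inE cardsT; case: eqP.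
move=> fg0.
have [i fi|none] := pickP (fun i : Iirr [set: G]%G => \sum_h f h * 'chi_i h != 0).
  by exists 'chi_i.
case/negP: fg0; have : \sum_i (\sum_h f h * 'chi[[set: G]%G]_i h) * ('chi_i g)^* = 0.
  by apply: big1 => i _; have /negbFE/eqP-> := none i; rewrite mul0r.
under eq_bigr do rewrite mulr_suml; rewrite exchange_big /= (bigD1 g) //=.
under eq_bigr do rewrite -mulrA.
rewrite -mulr_sumr orth eqxx big1 => [|h hg]; last first.
  under eq_bigr do rewrite -mulrA.
  by rewrite -mulr_sumr orth (negPf hg) mulr0.
move/eqP; rewrite addr0 mulf_eq0 pnatr_eq0 => /orP[//|/eqP G0].
by have := card0_eq G0 g; rewrite inE.
Qed.

Lemma character_complete (f1 f2 : G -> algC) :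
    (forall psi, is_character psi -> \sum_h f1 h * psi h = \sum_h f2 h * psi h) ->
  f1 =1 f2.
Proof.
move=> eqf g; apply/eqP; rewrite -subr_eq0; apply: contraT.
case/(character_nonvanishing (fun h => f1 h - f2 h)) => psi cpsi /negP[].
by under eq_bigr do rewrite mulrBl; rewrite sumrB eqf // subrr.
Qed.

(** Multiplication by k permutes [G] with inverse multiplication by j, so the dilation can be moved
    from [psi] to the coefficients. *)
Lemma character_units psi n k j (f : G -> algC) : (forall g : G, g *+ n = 0) ->
    (k * j = 1 %[mod n])%N ->
  \sum_h f h * psi (h *+ k) = \sum_h f (h *+ j) * psi h.
Proof.
move=> Gn kj; have kjK (h : G) : h *+ k *+ j = h.
  have mulmod (i : nat) : h *+ i = h *+ (i %% n).
    by rewrite {1}(divn_eq i n) mulrnDr mulnC mulrnA Gn mul0rn add0r.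
  by rewrite -mulrnA mulmod kj -mulmod.
rewrite [RHS](reindex (fun h => h *+ k)); first by under [RHS]eq_bigr do rewrite kjK.
exists (fun h => h *+ j) => h _ //=; by rewrite mulrnAC.
Qed.

Definition cayley_mx (f : G -> algC) : 'M[algC]_#|G| :=
  \matrix_(i, j) f (enum_val j - enum_val i).

Lemma sum_enum_val (F : G -> algC) : \sum_(i < #|G|) F (enum_val i) = \sum_g F g.
Proof. by rewrite -big_enum_val. Qed.

(** [eigenvalue] refers to row vectors. The column of values of [psi] is a right eigenvector; a left
    eigenvector pairs nontrivially with one such column, which forces its eigenvalue to be that
    Fourier coefficient. Conversely, the row of values psi(-g) is a left eigenvector. *)
Lemma cayley_mx_eigenvalueP f a :
  eigenvalue (cayley_mx f) a <-> exists2 psi, is_character psi & a = \sum_h f h * psi h.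
Proof.
split=> [/eigenvalueP[v vM v0]|[psi [p0 pD] ->]].
  have [i vi] : exists i, v 0 i != 0.
    by case/rV0Pn: v0 => i; exists i.
  have [|psi cpsi] := character_nonvanishing (fun g => v 0 (enum_rank g)) (enum_val i).
    by rewrite enum_valK.
  move=> s0; exists psi => //; have [p0 pD] := cpsi.
  apply: (mulIf s0).
  pose c : 'cV_#|G| := \col_j psi (enum_val j).
  have Mc : cayley_mx f *m c = (\sum_h f h * psi h) *: c.
    apply/colP=> j; rewrite !mxE mulr_suml.
    rewrite (eq_bigr (fun j' => (fun g => f (g - enum_val j) * psi g) (enum_val j')));
      last first.
      by move=> j' _; rewrite !mxE.
    rewrite (sum_enum_val (fun g => f (g - enum_val j) * psi g)).
    rewrite (reindex_inj (addIr (enum_val j))); apply: eq_bigr => g _.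
    by rewrite addrK pD mulrA.
  have vc : \sum_h v 0 (enum_rank h) * psi h = (v *m c) 0 0.
    rewrite mxE -sum_enum_val; apply: eq_bigr => j _; by rewrite enum_valK mxE.
  have := congr1 (fun A : 'M_1 => A 0 0) (congr1 (mulmx^~ c) vM).
  by rewrite vc /= -mulmxA Mc -scalemxAl -scalemxAr !mxE => <-.
apply/eigenvalueP; exists (\row_i psi (- enum_val i)).
  apply/rowP=> j; rewrite !mxE mulr_suml.
  rewrite (eq_bigr (fun i => (fun g => psi (- g) * f (enum_val j - g)) (enum_val i)));
    last first.
    by move=> i _; rewrite !mxE.
  rewrite (sum_enum_val (fun g => psi (- g) * f (enum_val j - g))).
  rewrite (reindex_inj (inj_comp (addrI (enum_val j)) oppr_inj)).
  by apply: eq_bigr => g _; rewrite /= opprD opprK addrA subrr add0r addrC pD mulrC mulrA.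
apply/rV0Pn; exists (enum_rank 0); rewrite mxE enum_rankK oppr0 p0.
exact: oner_neq0.
Qed.
End Characters.

Section SignedIndicator.
Variables (G : finZmodType) (C1 C2 : {set G}).

Definition signed_indicator (g : G) : algC := (g \in C1)%:R - (g \in C2)%:R.

Lemma signed_indicator_rat (u : {rmorphism algC -> algC}) g :
  u (signed_indicator g) = signed_indicator g.
Proof. by rewrite rmorphB !rmorph_nat. Qed.

Lemma Amat_cayley : Amat C1 - Amat C2 = cayley_mx G signed_indicator.
Proof. by apply/matrixP=> i j; rewrite !mxE. Qed.

Hypothesis disC : [disjoint C1 & C2].

(** Disjointness allows both sets to be recovered as fibres of the signed indicator. *)
Lemma signed_indicator_eq1 g : (signed_indicator g == 1) = (g \in C1).
Proof.
rewrite /signed_indicator; have [g1|_] := boolP (g \in C1).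
  by rewrite (disjointFr disC g1) subr0 eqxx.
by case: (g \in C2); rewrite ?subr0 ?sub0r eq_sym ?oner_eq0 //
  -subr_eq0 opprK -mulr2n pnatr_eq0.
Qed.

Lemma signed_indicator_eqN1 g : (signed_indicator g == -1) = (g \in C2).
Proof.
rewrite /signed_indicator; have [g2|_] := boolP (g \in C2).
  by rewrite (disjointFl disC g2) sub0r eqxx.
by case: (g \in C1); rewrite subr0 ?[0 == _]eq_sym ?oppr_eq0 ?oner_eq0 //
  -subr_eq0 opprK -mulr2n pnatr_eq0.
Qed.
End SignedIndicator.

(** * The character of a quadratic subfield *)

(** Q(z) is normal: u(p(z)) = p(z^k), the value at [z] of p composed with X^k. *)
Lemma in_cyclo_aut_closed n k z x (u : {rmorphism algC -> algC}) :
  n.-primitive_root z -> acts_as_power n k u -> in_cyclo z x -> in_cyclo z (u x).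
Proof.
move=> zn hu [p ->]; exists (p \Po 'X^k).
rewrite map_comp_poly map_polyXn horner_comp hornerXn -horner_map.
rewrite (hu _ (prim_expr_order zn)) -map_poly_comp; congr _.[_].
by apply: eq_map_poly => a /=; rewrite fmorph_rat.
Qed.

Lemma acts_as_power_mod n k u : acts_as_power n k u -> acts_as_power n (k %% n) u.
Proof. by move=> hu y yn; rewrite hu // expr_mod. Qed.

Lemma acts_as_power_comp n k l (u v : {rmorphism algC -> algC}) :
  acts_as_power n k u -> acts_as_power n l v -> acts_as_power n (k * l) (u \o v).
Proof. by move=> hu hv y yn; rewrite /= hv // rmorphXn hu //= exprM. Qed.

(** A root of unity has modulus 1, so its conjugate is its inverse. *)
Lemma conj_acts_as_power n : (0 < n)%N -> acts_as_power n n.-1 Num.conj.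
Proof.
move=> n0 y yn; have y0 : y != 0.
  by apply: contra_eq_neq yn => ->; rewrite expr0n eqn0Ngt n0 eq_sym oner_neq0.
apply: (mulfI y0); rewrite -exprS prednK // yn -normCK.
have /eqP : `|y| ^+ n = 1 by rewrite -normrX yn normr1.
by rewrite pexpr_eq1 // => /eqP->; rewrite expr1n.
Qed.

Section QuadraticCharacter.
Variables (n : nat) (z : algC) (D : int) (c : nat -> int) (d : algC).
Hypotheses (zn : n.-primitive_root z) (sqD : squarefree D).
Hypotheses (dz : in_cyclo z d) (dD : d ^+ 2 = D%:~R).
Hypothesis cd : forall k (u : {rmorphism algC -> algC}), coprime k n ->
  acts_as_power n k u -> u d = (c k)%:~R * d.

Let n_gt0 : (0 < n)%N := prim_order_gt0 zn.

Lemma squarefree_neq0 : D != 0.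
Proof. by apply: contraTneq (sqD 2%N isT) => ->. Qed.

Lemma quad_root_neq0 : d != 0.
Proof. by rewrite -sqrf_eq0 dD intr_eq0 squarefree_neq0. Qed.

(** As d != 0, a single automorphism determines [c k]; the properties of [c] below are obtained by
    exhibiting one. *)
Lemma quad_char_eq k e (u : {rmorphism algC -> algC}) : coprime k n ->
  acts_as_power n k u -> u d = e%:~R * d -> c k = e.
Proof.
move=> co hu; rewrite (cd k u co hu) => /(mulIf quad_root_neq0).
by move/eqP; rewrite eqr_int => /eqP.
Qed.

Lemma quad_char_sign k : coprime k n -> c k = 1 \/ c k = -1.
Proof.
move=> co; have [u hu] := Qn_aut_exists co.
have : u (d ^+ 2) = d ^+ 2 by rewrite dD rmorph_int.
rewrite rmorphXn /= (cd k u co hu) exprMn -[RHS]mul1r.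
move/(mulIf (expf_neq0 2 quad_root_neq0)) => /eqP.
by rewrite -rmorphXn (eqr_int _ _ 1) sqrf_eq1 => /orP[]/eqP; [left|right].
Qed.

Lemma quad_char_mod k : coprime k n -> c (k %% n) = c k.
Proof.
move=> co; have [u hu] := Qn_aut_exists co.
apply: (quad_char_eq _ _ u); rewrite ?coprime_modl ?(cd k u) //.
exact: acts_as_power_mod.
Qed.

Lemma quad_charM k l : coprime k n -> coprime l n -> c (k * l) = c k * c l.
Proof.
move=> cok col; have [u hu] := Qn_aut_exists cok; have [v hv] := Qn_aut_exists col.
apply: (quad_char_eq _ _ (u \o v)); first by rewrite coprimeMl cok.
  exact: acts_as_power_comp.
rewrite /= (cd l v col hv) rmorphM rmorph_int (cd k u cok hu).
by rewrite mulrCA rmorphM mulrA.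
Qed.

Lemma quad_char_trivial k : D = 1 -> coprime k n -> c k = 1.
Proof.
move=> D1 co; have [u hu] := Qn_aut_exists co.
apply: (quad_char_eq _ _ u) => //; rewrite mul1r.
by move/eqP: dD; rewrite D1 sqrf_eq1 => /orP[]/eqP->; rewrite ?rmorphN1 ?rmorph1.
Qed.

(* If c were trivial, d would be rational and D a rational square. *)
Lemma quad_char_nontrivial : D != 1 ->
  exists k, [/\ (k < n)%N, coprime k n & c k = -1].
Proof.
move=> D1; have [k /andP[co /eqP ck]|none] :=
  pickP (fun k : 'I_n => coprime k n && (c k == -1)); first by exists k.
case/eqP: D1; have /CratP[s ds] : d \in Crat.
  apply: (cyclo_fixed_rat n z) => // k u co hu.
  rewrite (cd k u co hu) -(quad_char_mod k co).
  have [|->|cN] := quad_char_sign (k %% n); rewrite ?coprime_modl ?mul1r //.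
  by have := none (Ordinal (ltn_pmod k n_gt0)); rewrite /= coprime_modl co cN.
apply: (squarefree_sqr _ s sqD); apply: (fmorph_inj (ratr : {rmorphism rat -> algC})).
by rewrite rmorphXn /= -ds dD ratr_int.
Qed.

Lemma coprime_predn : coprime n.-1 n.
Proof. by rewrite coprime_sym -{1}(prednK n_gt0) coprimeSn. Qed.

(** Conjugation is the power n - 1, so c(n-1) D = d conj(d) = |d|^2. Hence c(n-1) is the sign of
    [D]. *)
Lemma quad_char_predn : (c n.-1)%:~R * D%:~R >= 0 :> algC.
Proof.
have := cd n.-1 Num.conj coprime_predn (conj_acts_as_power n n_gt0).
move/(congr1 (fun x => d * x)); rewrite -normCK mulrCA -expr2 dD => <-.
by rewrite exprn_ge0.
Qed.

Lemma quad_char_predn_neg : D < 0 -> c n.-1 = -1.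
Proof.
have [ck|//] := quad_char_sign _ coprime_predn.
by have := quad_char_predn; rewrite ck mul1r ler0z => D0 /(le_lt_trans D0); rewrite ltxx.
Qed.

Lemma quad_char_predn_pos : 0 < D -> c n.-1 = 1.
Proof.
have [//|ck] := quad_char_sign _ coprime_predn.
have := quad_char_predn; rewrite ck rmorphN1 mulN1r oppr_ge0 lerz0.
by move=> D0 /lt_le_trans/(_ D0); rewrite ltxx.
Qed.

(* The two eigen-components x + u x and (x - u x) d of an involution u with
   u d = - d are fixed by all automorphisms. *)
Lemma quad_fixed x : in_cyclo z x ->
    (forall k (u : {rmorphism algC -> algC}), coprime k n -> acts_as_power n k u ->
       c k = 1 -> u x = x) ->
  exists r s : rat, x = ratr r + ratr s * d.
Proof.
move=> xz fix_x; have [D1|D1] := eqVneq D 1.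
  have /CratP[r ->] : x \in Crat.
    apply: (cyclo_fixed_rat n z) => // k u co hu; apply: (fix_x k u co hu).
    exact: quad_char_trivial.
  by exists r, 0; rewrite rmorph0 mul0r addr0.
have [k0 [_ co0 c0]] := quad_char_nontrivial D1.
have [v hv] := Qn_aut_exists co0.
have vd : v d = - d by rewrite (cd k0 v co0 hv) c0 mulN1r.
have vv : v (v x) = x.
  apply: (fix_x (k0 * k0)%N (v \o v)); first by rewrite coprimeMl co0.
    exact: acts_as_power_comp.
  by rewrite quad_charM // c0.
(* All automorphisms of sign -1 agree on [x], since composing any of them with [v] gives sign 1. *)
have uv k (u : {rmorphism algC -> algC}) : coprime k n -> acts_as_power n k u ->
    c k = -1 -> u x = v x.
  move=> co hu ck; apply: (fmorph_inj v); rewrite vv.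
  apply: (fix_x (k0 * k)%N (v \o u)); first by rewrite coprimeMl co0.
    exact: acts_as_power_comp.
  by rewrite quad_charM // c0 ck.
(* The Galois group of Q(z) is abelian: both composites send [z] to the same power. *)
have uvC k (u : {rmorphism algC -> algC}) : acts_as_power n k u ->
    u (v x) = v (u x).
  move=> hu; apply: (in_cyclo_aut z x (u \o v) (v \o u)) xz => /=.
  have z1 := prim_expr_order zn.
  by rewrite (hv _ z1) (hu _ z1) !rmorphXn /= (hv _ z1) (hu _ z1) -!exprM mulnC.
have vz := in_cyclo_aut_closed n k0 z x v zn hv xz.
have /CratP[r rE] : x + v x \in Crat.
  apply: (cyclo_fixed_rat n z) => // [|k u co hu]; first exact: in_cycloD.
  rewrite rmorphD /= (uvC k u hu); have [ck|ck] := quad_char_sign k co.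
    by rewrite (fix_x k u).
  by rewrite (uv k u) // vv addrC.
have /CratP[s sE] : (x - v x) * d \in Crat.
  apply: (cyclo_fixed_rat n z) => // [|k u co hu].
    apply: in_cycloM => //; apply: in_cycloD => //.
    by rewrite -mulN1r; apply: in_cycloM vz; apply: (in_cyclo_int z (-1)).
  rewrite rmorphM rmorphB /= (uvC k u hu) (cd k u co hu).
  have [ck|ck] := quad_char_sign k co; first by rewrite ck mul1r (fix_x k u).
  by rewrite ck (uv k u) // vv mulN1r mulrN -mulNr opprB.
(* Here r = x + v x and s = (x - v x) d; as d^2 = D, half the sum of r and s d / D is x. *)
exists (r / 2), (s / (2 * D%:~R)).
rewrite !rmorphM !fmorphV /= !rmorphM /= ratr_nat ratr_int -rE -sE -dD.
have d0 := quad_root_neq0; have t0 : 2 != 0 :> algC by rewrite pnatr_eq0.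
by field.
Qed.

(** The statement uses the principal root [sqrtC], whereas [d] is built from Gauss sums, whose sign
    is left undetermined. *)
Lemma sqrtC_quad : sqrtC D%:~R = d \/ sqrtC D%:~R = - d.
Proof.
have := sqrtCK (D%:~R : algC); rewrite -dD => /eqP.
by rewrite eqf_sqr => /orP[]/eqP; [left|right].
Qed.

Lemma sqrtC_quad_aut k (u : {rmorphism algC -> algC}) :
  coprime k n -> acts_as_power n k u -> u (sqrtC D%:~R) = (c k)%:~R * sqrtC D%:~R.
Proof.
move=> co hu; case: sqrtC_quad => ->; rewrite ?rmorphN (cd k u co hu) //.
by rewrite mulrN.
Qed.
End QuadraticCharacter.

(** * Galois action on the spectrum *)

Lemma coprime_mod_inv n k : coprime k n -> exists j, (k * j = 1 %[mod n])%N.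
Proof.
(* The Chinese remainder solution for residues 0 modulo k and 1 modulo n is k times this Bezout
   coefficient. *)
move=> co; exists (egcdn k n).1; have := chinese_modr co 0 1.
by rewrite /chinese mul0n add0n mul1n.
Qed.

Section CayleySpectrum.
Variables (G : finZmodType) (n : nat) (z : algC).
Hypotheses (Gn : forall g : G, g *+ n = 0) (zn : n.-primitive_root z).

Lemma mulrn_mod (g : G) k : g *+ (k %% n) = g *+ k.
Proof. by rewrite {2}(divn_eq k n) mulrnDr mulnC mulrnA Gn mul0rn add0r. Qed.

Lemma mulrnK k j (g : G) : (k * j = 1 %[mod n])%N -> g *+ k *+ j = g.
Proof. by move=> kj; rewrite -mulrnA -mulrn_mod kj mulrn_mod. Qed.

Lemma character_unity (psi : G -> algC) g : is_character G psi -> psi g ^+ n = 1.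
Proof. by move=> cpsi; rewrite -(characterMn _ _ _ _ cpsi) Gn; case: cpsi. Qed.

Variables C1 C2 : {set G}.
Hypothesis disC : [disjoint C1 & C2].
Let f := signed_indicator G C1 C2.
Let ev (psi : G -> algC) := \sum_h f h * psi h.

Lemma eigen_in_cyclo psi : is_character G psi -> in_cyclo z (ev psi).
Proof.
move=> cpsi; apply: in_cyclo_sum => h; apply: in_cycloM.
  have -> : f h = ((h \in C1)%:Z - (h \in C2)%:Z)%:~R by rewrite rmorphB.
  exact: in_cyclo_int.
have [i ->] := prim_rootP zn (character_unity psi h cpsi).
exact: in_cyclo_exp.
Qed.

Lemma eigen_Aint psi : is_character G psi -> ev psi \in Aint.
Proof.
move=> cpsi; apply: rpred_sum => h _; apply: rpredM.
  have -> : f h = ((h \in C1)%:Z - (h \in C2)%:Z)%:~R by rewrite rmorphB.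
  exact: Aint_int.
apply: (Aint_unity_root (prim_order_gt0 zn)); apply/unity_rootP.
exact: character_unity.
Qed.

(* Applying u to the Fourier transform of f gives that of g |-> f(k^-1 g). *)
Lemma eigen_aut_scale k (u : {rmorphism algC -> algC}) (e : algC) :
    coprime k n -> acts_as_power n k u -> e * e = 1 ->
  (forall psi, is_character G psi -> u (ev psi) = e * ev psi) <->
  (forall g, f (g *+ k) = e * f g).
Proof.
move=> co hu ee; have [j kj] := coprime_mod_inv n k co.
have jk : (j * k = 1 %[mod n])%N by rewrite mulnC.
have uE psi : is_character G psi -> u (ev psi) = \sum_h f (h *+ j) * psi h.
  move=> cpsi; rewrite -(character_units _ psi n k j f Gn kj) rmorph_sum.
  apply: eq_bigr => h _; rewrite rmorphM /= signed_indicator_rat hu.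
    by rewrite (characterMn _ _ _ _ cpsi).
  exact: character_unity.
split=> [eqf g|eqf psi cpsi].
  suff fj : (fun h => f (h *+ j)) =1 (fun h => e * f h).
    by have /= := fj (g *+ k); rewrite mulrnK // => ->; rewrite mulrA ee mul1r.
  apply: character_complete => psi cpsi; rewrite -uE // eqf // mulr_sumr.
  by apply: eq_bigr => h _; rewrite mulrA.
rewrite uE // mulr_sumr; apply: eq_bigr => h _.
by have -> : f h = e * f (h *+ j); rewrite ?mulrA ?ee ?mul1r // -eqf mulrnK.
Qed.

Variables (D : int) (w0 w : bool) (S : seq nat).
Let c k : int := chi8 k ^+ w0 * sym4 k ^+ w * \prod_(p <- S) legendre k p.
Hypothesis sqD : squarefree D.
Variable d : algC.
Hypotheses (dz : in_cyclo z d) (dD : d ^+ 2 = D%:~R).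
Hypothesis cd : forall k (u : {rmorphism algC -> algC}), coprime k n ->
  acts_as_power n k u -> u d = (c k)%:~R * d.

Let n_gt0 : (0 < n)%N := prim_order_gt0 zn.
Let chi_mod := quad_char_mod n D c d sqD dD cd.
Let chi_M := quad_charM n D c d sqD dD cd.
Let chi_sign := quad_char_sign n D c d sqD dD cd.

Lemma inHE k : inH n w0 w S k = unit_mod n k && (c k == 1).
Proof. by []. Qed.

Lemma inH_mod k : coprime k n -> c k = 1 -> inH n w0 w S (k %% n).
Proof.
move=> co ck; rewrite inHE /unit_mod ltn_mod n_gt0 coprime_modl co.
by rewrite chi_mod // ck eqxx.
Qed.

Lemma unions_invariant :
  (union_of_classes n w0 w S C1 /\ union_of_classes n w0 w S C2) <->
  (forall k, coprime k n -> c k = 1 -> forall g, f (g *+ k) = f g).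
Proof.
split=> [[u1 u2] k co ck g|inv].
  have sim : simD n w0 w S (g *+ k) g.
    (* [inH] admits only representatives below n, hence the reduction. *)
    by exists (k %% n)%N; rewrite inH_mod // mulrn_mod.
  by rewrite /f /signed_indicator (u1 _ _ sim) (u2 _ _ sim).
split=> g h [k [/andP[/andP[_ co] /eqP ck] ->]].
  by rewrite -!(signed_indicator_eq1 _ _ _ disC) -/f inv.
by rewrite -!(signed_indicator_eqN1 _ _ _ disC) -/f inv.
Qed.

Lemma scale_antiinvariant k : coprime k n ->
  (forall g, f (g *+ k) = - f g) -> C2 = scale_set k C1.
Proof.
move=> co inv; have [j kj] := coprime_mod_inv n k co.
have mem g : (g *+ k \in C2) = (g \in C1).
  rewrite -(signed_indicator_eqN1 _ _ _ disC) -/f inv eqr_opp.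
  exact: signed_indicator_eq1.
apply/setP=> g; apply/idP/imsetP=> [g2|[h h1 ->]]; last by rewrite mem.
have gE : g = g *+ j *+ k by rewrite mulrnK // mulnC.
by exists (g *+ j); rewrite // -mem -gE.
Qed.

(** c(k^2) = 1 puts k^2 in H_Delta, so k C2 = k^2 C1 = C1: multiplication by k exchanges the two
    sets. *)
Lemma scale_invariant k : coprime k n -> c k = -1 ->
    union_of_classes n w0 w S C1 -> C2 = scale_set k C1 ->
  union_of_classes n w0 w S C2 /\ forall g, f (g *+ k) = - f g.
Proof.
move=> co ck u1 C2E; have [j kj] := coprime_mod_inv n k co.
have jk : (j * k = 1 %[mod n])%N by rewrite mulnC.
have mem2 g : (g *+ k \in C2) = (g \in C1).
  rewrite C2E [LHS]mem_imset // => x y /(congr1 (fun t => t *+ j)).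
  by rewrite !mulrnK.
have mem2' g : (g \in C2) = (g *+ j \in C1) by rewrite -mem2 mulrnK.
have mem1 g : (g *+ k \in C1) = (g \in C2).
  rewrite mem2'; apply: u1; exists ((k * k) %% n)%N; split.
    by apply: inH_mod; rewrite ?coprimeMl ?co // chi_M // ck.
  by rewrite mulrn_mod mulrnA (mulrnK j k g jk).
split=> [g h [i [iH ->]]|g].
  by rewrite !mem2'; apply: u1; exists i; split=> //; rewrite mulrnAC.
by rewrite /f /signed_indicator mem1 mem2 opprB.
Qed.

(** If c(k) = -1 then k k0 has sign 1, so f(kg) = -f(k k0 g) = -f(g). *)
Lemma eigen_transform k0 :
    (union_of_classes n w0 w S C1 /\ union_of_classes n w0 w S C2) ->
    coprime k0 n -> c k0 = -1 -> (forall g, f (g *+ k0) = - f g) ->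
  forall k g, coprime k n -> f (g *+ k) = (c k)%:~R * f g.
Proof.
move=> /unions_invariant inv co0 c0 anti k g co.
have [ck|ck] := chi_sign k co; first by rewrite ck mul1r inv.
rewrite ck mulN1r -[LHS]opprK -anti -mulrnA inv ?coprimeMl ?co //.
by rewrite chi_M // ck c0.
Qed.
End CayleySpectrum.

(** * The two spectral equivalences and the sign of Delta *)

Lemma aut_rat_comb (u : {rmorphism algC -> algC}) (r s : rat) x :
  u (ratr r + ratr s * x) = ratr r + ratr s * u x.
Proof. by rewrite rmorphD fmorph_rat [u (_ * _)]rmorphM fmorph_rat. Qed.

Lemma mem_neg_set (G : finZmodType) (C : {set G}) g : (g \in neg_set C) = (- g \in C).
Proof. by rewrite -{1}[g]opprK [LHS]mem_imset //; apply: oppr_inj. Qed.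

Theorem theorem8p1 (G : finZmodType) (n1 : nat) (w0 w : bool) (S : seq nat)
    (C1 C2 : {set G})
    (Hexp : is_exponent G n1)
    (HSuniq : uniq S)
    (HS : forall p, p \in S -> [&& prime p, odd p & (p %| n1)%N])
    (Hw0 : w0 -> (8 %| n1)%N)
    (Hw : w -> (4 %| n1)%N)
    (Hdisj : [disjoint C1 & C2])
    (H0 : 0 \notin C1 :|: C2) :
  let Dl := Delta w0 w S in
  let M := Amat C1 - Amat C2 in
  (* (i) *)
  ((forall a : algC, eigenvalue M a ->
      exists r s : rat, a = ratr r + ratr s * sqrtC (Dl%:~R)) <->
   (union_of_classes n1 w0 w S C1 /\ union_of_classes n1 w0 w S C2)) /\
  (* (ii) *)
  ((forall a : algC, eigenvalue M a ->
      exists z : int, a = z%:~R * sqrtC (Dl%:~R)) <->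
   ((Dl = 1 /\ union_of_classes n1 false false [::] C1
            /\ union_of_classes n1 false false [::] C2) \/
    (Dl != 1 /\ union_of_classes n1 w0 w S C1 /\
     exists k, unit_mod n1 k /\ ~~ inH n1 w0 w S k /\ C2 = scale_set k C1))) /\
  (* moreover *)
  ((Dl != 1 /\ union_of_classes n1 w0 w S C1 /\
     (exists k, unit_mod n1 k /\ ~~ inH n1 w0 w S k /\ C2 = scale_set k C1)) ->
   (Dl < 0 -> [/\ C2 = neg_set C1, [disjoint C1 & neg_set C1]
                & M = Amat C1 - (Amat C1)^T]) /\
   (0 < Dl -> [/\ C1 = neg_set C1, C2 = neg_set C2 & M^T = M])).
Proof.
move=> D M; have [n0 [Gn _]] := Hexp; have [z zn] := C_prim_root_exists n0.
pose c k : int := chi8 k ^+ w0 * sym4 k ^+ w * \prod_(p <- S) legendre k p.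
have [d [dz dD cd0]] := quadratic_Delta n1 z zn w0 w S HS Hw0 Hw.
have sqD : squarefree D.
  by apply: squarefree_Delta => // p /HS/and3P[-> ->].
rewrite -/D in dD.
have cd k (u : {rmorphism algC -> algC}) : coprime k n1 -> acts_as_power n1 k u ->
    u d = (c k)%:~R * d by exact: cd0.
pose f := signed_indicator G C1 C2.
pose sq : algC := sqrtC D%:~R.
have sqaut k (u : {rmorphism algC -> algC}) : coprime k n1 ->
    acts_as_power n1 k u -> u sq = (c k)%:~R * sq.
  by move=> co hu; exact: (sqrtC_quad_aut _ _ _ _ dD cd).
have sqsq : sq * sq = D%:~R by rewrite -expr2 sqrtCK.
have evP a : eigenvalue M a <->
    exists2 psi, is_character G psi & a = \sum_h f h * psi h.
  by rewrite /M Amat_cayley; apply: cayley_mx_eigenvalueP.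
have scaleP := eigen_aut_scale G n1 Gn C1 C2; rewrite -/f in scaleP.
have invP : (union_of_classes n1 w0 w S C1 /\ union_of_classes n1 w0 w S C2) <->
    (forall k, coprime k n1 -> c k = 1 -> forall g, f (g *+ k) = f g).
  exact: (unions_invariant G n1 z Gn zn C1 C2 Hdisj D w0 w S sqD d dD cd).
have cS := quad_char_sign n1 D c d sqD dD cd.
have iP : (forall a : algC, eigenvalue M a ->
      exists r s : rat, a = ratr r + ratr s * sq) <->
   (union_of_classes n1 w0 w S C1 /\ union_of_classes n1 w0 w S C2).
  split=> [eig|/invP inv a /evP[psi cpsi ->]].
    (* An automorphism of sign 1 fixes sqrt(Delta), hence all eigenvalues; Fourier uniqueness then
       makes [f] invariant under k. *)
    apply/invP => k co ck g; have [u hu] := Qn_aut_exists co.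
    rewrite -[RHS]mul1r; move: g.
    apply: (proj1 (scaleP k u 1 co hu (mul1r 1))) => psi cpsi.
    have [|r [s ->]] := eig (\sum_h f h * psi h); first by apply/evP; exists psi.
    by rewrite aut_rat_comb (sqaut k u co hu) ck !mul1r.
  have [|k u co hu ck|r [s ->]] :=
      quad_fixed n1 z D c d zn sqD dz dD cd (\sum_h f h * psi h).
  - exact: eigen_in_cyclo.
  - rewrite -[RHS]mul1r; apply: (proj2 (scaleP k u 1 co hu (mul1r 1))) => // g.
    by rewrite mul1r inv.
  case: (sqrtC_quad D d dD) => sqE; first by exists r, s; rewrite /sq sqE.
  by exists r, (- s); rewrite /sq sqE rmorphN mulrNN.
have transform : D != 1 /\ union_of_classes n1 w0 w S C1 /\
     (exists k, unit_mod n1 k /\ ~~ inH n1 w0 w S k /\ C2 = scale_set k C1) ->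
   union_of_classes n1 w0 w S C2 /\
   forall k g, coprime k n1 -> f (g *+ k) = (c k)%:~R * f g.
  move=> [D1 [u1 [k [uk [nH C2E]]]]]; have /andP[_ co] := uk.
  have ck : c k = -1.
    by have [ck|//] := cS k co; move: nH; rewrite /inH uk -/(c k) ck.
  have [u2 anti] :=
    scale_invariant G n1 z Gn zn C1 C2 D w0 w S sqD d dD cd k co ck u1 C2E.
  split=> //; exact: (eigen_transform G n1 z Gn zn C1 C2 Hdisj D w0 w S sqD d dD cd k).
split; first exact: iP.
split.
  split=> [eig|].
    have [u1 u2] : union_of_classes n1 w0 w S C1 /\ union_of_classes n1 w0 w S C2.
      apply/iP => a /eig[m ->]; exists 0, m%:~R.
      by rewrite rmorph0 add0r ratr_int.
    have [D1|D1] := eqVneq D 1.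
      (* For Delta = 1 the character is trivial, so H_Delta is the whole unit group and its classes
         are those of ~_1. *)
      have sub k : unit_mod n1 k -> inH n1 w0 w S k.
        move=> uk; rewrite inHE uk; have /andP[_ co] := uk.
        by apply/eqP; apply: (quad_char_trivial n1 D c d sqD dD cd).
      left; split=> //; split=> g h [k [/andP[uk _] gE]].
        by apply: u1; exists k; rewrite sub.
      by apply: u2; exists k; rewrite sub.
    right; do 2!split=> //.
    have [k [kn co ck]] := quad_char_nontrivial n1 z D c d zn sqD dz dD cd D1.
    have uk : unit_mod n1 k by rewrite /unit_mod kn.
    exists k; do 2!split=> //; first by rewrite inHE uk -/(c k) ck.
    have [u hu] := Qn_aut_exists co.
    (* Since c(k) = -1, the automorphism negates sqrt(Delta) and so every eigenvalue; this is the
       scaling criterion with sign -1. *)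
    apply: (scale_antiinvariant G n1 Gn) => // g; rewrite -mulN1r -/f.
    move: g.
    apply: (proj1 (scaleP k u (-1) co hu _)) => [|psi cpsi].
      by rewrite mulrNN mul1r.
    have [|m ->] := eig (\sum_h f h * psi h); first by apply/evP; exists psi.
    by rewrite rmorphM rmorph_int (sqaut k u co hu) ck mulrCA.
  case=> [[D1 [u1 u2]] a ev_a|hyp a ev_a].
    have [r [s aE]] : exists r s : rat, a = ratr r + ratr s * sq.
      apply: (proj2 iP) ev_a; split=> g h [k [/andP[uk _] gE]].
        by apply: u1; exists k; rewrite /inH uk big_nil.
      by apply: u2; exists k; rewrite /inH uk big_nil.
    (* With sqrt(Delta) = 1 the eigenvalue is rational, and as an algebraic integer it is an
       integer. *)
    have aQ : a \in Crat.
      by rewrite aE /sq D1 sqrtC1 mulr1 -rmorphD Crat_rat.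
    have aA : a \in Aint.
      by have /evP[psi cpsi ->] := ev_a; apply: (eigen_Aint G n1 z).
    have /intrP[m ->] := Cint_rat_Aint aQ aA.
    by exists m; rewrite D1 sqrtC1 mulr1.
  have [u2 tr] := transform hyp; have [D1 [u1 _]] := hyp.
  have [r [s aE]] := proj2 iP (conj u1 u2) a ev_a.
  have [k [kn co ck]] := quad_char_nontrivial n1 z D c d zn sqD dz dD cd D1.
  have [u hu] := Qn_aut_exists co.
  have ua : u a = - a.
    have /evP[psi cpsi ->] := ev_a; rewrite -mulN1r.
    apply: (proj2 (scaleP k u (-1) co hu _)) => // [|g]; first by rewrite mulrNN mul1r.
    by rewrite tr // ck.
  (* [u] fixes [r] and negates [sq], so 0 = u a + a = 2r. *)
  have r0 : ratr r = 0 :> algC.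
    have : u a + a = 0 by rewrite ua addNr.
    rewrite aE aut_rat_comb (sqaut k u co hu) ck mulN1r mulrN.
    rewrite addrACA addNr addr0 => /eqP.
    by rewrite -mulr2n -mulr_natr mulf_eq0 pnatr_eq0 orbF => /eqP.
  rewrite r0 add0r in aE.
  have aA : a \in Aint.
    by have /evP[psi cpsi ->] := ev_a; apply: (eigen_Aint G n1 z).
  (* a^2 = s^2 Delta is a rational algebraic integer, hence an integer, and Delta is squarefree. *)
  have /intrP[m sm] : s \is a Num.int.
    apply: (squarefree_mul_sqr D) => //.
    have aaE : a * a = ratr (s ^+ 2 * D%:~R).
      by rewrite aE mulrACA sqsq expr2 [RHS]rmorphM /= [ratr (s * s)]rmorphM ratr_int.
    have : a * a \is a Num.int.
      by apply: Cint_rat_Aint; [rewrite aaE Crat_rat | apply: rpredM].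
    rewrite aaE => /intrP[m']; rewrite -[m'%:~R]ratr_int => /fmorph_inj->.
    exact: intr_int.
  by exists m; rewrite aE sm ratr_int.
move=> /transform[u2 tr].
(* -g = (n1 - 1) g, and c(n1 - 1) is the sign of Delta, so [f] is odd or even accordingly. *)
have fN g : f (- g) = (c n1.-1)%:~R * f g.
  rewrite -tr ?coprime_predn //; last exact: coprime_predn n1 z zn.
  congr f; apply/eqP; rewrite eq_sym -addr_eq0 -mulrSr prednK //.
  by rewrite Gn.
have f1 g : (f g == 1) = (g \in C1) by apply: signed_indicator_eq1.
have fN1 g : (f g == -1) = (g \in C2) by apply: signed_indicator_eqN1.
split=> Ds.
  have cN := quad_char_predn_neg n1 z D c d zn sqD dD cd Ds.
  have C2E : C2 = neg_set C1.
    by apply/setP=> g; rewrite mem_neg_set -f1 -fN1 fN cN mulN1r eqr_oppLR.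
  split=> //; first by rewrite -C2E.
  rewrite /M C2E; congr (_ - _); apply/matrixP=> i j.
  by rewrite !mxE mem_neg_set opprB.
have cP := quad_char_predn_pos n1 z D c d zn sqD dD cd Ds.
split.
- by apply/setP=> g; rewrite mem_neg_set -!f1 fN cP mul1r.
- by apply/setP=> g; rewrite mem_neg_set -!fN1 fN cP mul1r.
rewrite /M Amat_cayley -/f; apply/matrixP=> i j.
by rewrite !mxE -opprB fN cP mul1r.
Qed.
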